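(* Let $X$ and $Y$ be non-trivial real Banach spaces, let $H$ be a closed subspace of $\mathcal{L}(X,Y)$ containing the finite rank operators, and let $\delta>0$. Suppose that $H$ is weakly $\delta$-average rough. (a) If $X^\ast$ is non-rough, then $Y$ is weakly $\delta$-average rough. (b) If $Y$ is non-rough, then $X^\ast$ is weakly $\delta$-average rough.
   Context: For Banach spaces $X,Y$, $\mathcal{L}(X,Y)$ is the Banach space of all bounded linear operators from $X$ to $Y$ with the operator norm, $X^\ast$ is the dual of $X$, and $B_X$, $S_X$ are the closed unit ball and unit sphere of $X$. ''$H$ contains the finite rank operators'' means that $H$ contains all bounded finite rank operators from $X$ to $Y$; $H$ carries the operator norm. Let $Z$ be a Banach space and $\delta>0$. $Z$ is weakly $\delta$-average rough if every non-empty relatively weak$^\ast$ open subset of $B_{Z^\ast}$ (weak$^\ast$ topology $\sigma(Z^\ast,Z)$) has norm diameter greater than or equal to $\delta$. $Z$ is $\delta$-rough if, for every $z\in S_Z$, \[\limsup_{\|y\|\to 0}\frac{\|z+y\|+\|z-y\|-2}{\|y\|}\geq\delta\] (limsup over $y\in Z\setminus\{0\}$); $Z$ is non-rough if there is no $\varepsilon>0$ such that $Z$ is $\varepsilon$-rough. *)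

(* Defs.v *)
From HB Require Import structures.
From mathcomp Require Import all_boot all_order all_algebra.
From mathcomp Require Import all_classical all_reals all_analysis.

Set Implicit Arguments.
Unset Strict Implicit.
Unset Printing Implicit Defensive.

Import Order.TTheory GRing.Theory Num.Theory.
Import numFieldNormedType.Exports.

Local Open Scope classical_set_scope.
Local Open Scope ring_scope.

Section BoundedOperators.
Context {R : realType}.
Variables (X Y : normedModType R).

Definition bounded_linear : {pred X -> Y} :=
  fun f => `[< linear f /\ exists M, forall x, `|f x| <= M * `|x| >].

Lemma bounded_linear_submod_closed : submod_closed bounded_linear.
Proof.
split=> [|a f g /asboolP[lf [M fM]] /asboolP[lg [N gN]]].
  apply/asboolP; split=> [a x y|]; first by rewrite /GRing.zero/= scaler0 addr0.
  by exists 0 => x; rewrite /GRing.zero/= normr0 mul0r.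
apply/asboolP; split=> [b x y|].
  rewrite !fctE /= lf lg !scalerDr !scalerA (mulrC a b) -!addrA.
  by congr (_ + _); rewrite addrCA.
exists (`|a| * M + N) => x; rewrite !fctE.
rewrite (le_trans (ler_normD _ _))// normrZ mulrDl -mulrA.
by rewrite lerD// ler_wpM2l.
Qed.

HB.instance Definition _ := GRing.isSubmodClosed.Build R (X -> Y)
  bounded_linear bounded_linear_submod_closed.

Record bounded_op := BoundedOp {
  bounded_op_val :> X -> Y ;
  bounded_opP : bounded_op_val \in bounded_linear }.

HB.instance Definition _ := [isSub for bounded_op_val].
HB.instance Definition _ := [Choice of bounded_op by <:].
HB.instance Definition _ := [SubChoice_isSubLmodule of bounded_op by <:].

Lemma bounded_op_linear (f : bounded_op) : linear f.
Proof. by have /asboolP[] := bounded_opP f. Qed.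

HB.instance Definition _ (f : bounded_op) :=
  GRing.isLinear.Build R X Y *:%R f (bounded_op_linear f).

Definition op_norm (f : bounded_op) : R :=
  sup [set `|f x| | x in [set x : X | `|x| <= 1]].

Lemma bounded_op_has_sup (f : bounded_op) :
  has_sup [set `|f x| | x in [set x : X | `|x| <= 1]].
Proof.
split; first by exists `|f 0|; exists 0 => //=; rewrite normr0 ler01.
have /asboolP[_ [M fM]] := bounded_opP f.
exists `|M| => _ [x /= x1 <-]; rewrite (le_trans (fM x))//.
by rewrite (le_trans (ler_wpM2r _ (ler_norm M)))// ler_piMr.
Qed.

Lemma op_norm_ub (f : bounded_op) (x : X) : `|x| <= 1 -> `|f x| <= op_norm f.
Proof. by move=> x1; apply: (sup_upper_bound (bounded_op_has_sup f)); exists x. Qed.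

Lemma op_norm_ge0 (f : bounded_op) : 0 <= op_norm f.
Proof. by rewrite (le_trans _ (op_norm_ub f (x := 0) _)) ?normr0. Qed.

Lemma op_norm_le (f : bounded_op) (M : R) :
  (forall x, `|x| <= 1 -> `|f x| <= M) -> op_norm f <= M.
Proof.
move=> fM; apply: ge_sup; first by case: (bounded_op_has_sup f).
by move=> _ [x x1 <-]; exact: fM.
Qed.

Lemma op_normP (f : bounded_op) (x : X) : `|f x| <= op_norm f * `|x|.
Proof.
have [->|x0] := eqVneq x 0; first by rewrite linear0 !normr0 mulr0.
rewrite -ler_pdivrMr ?normr_gt0// mulrC.
have -> : `|x|^-1 * `|f x| = `|f (`|x|^-1 *: x)|.
  by rewrite linearZ/= normrZ ger0_norm// invr_ge0.
by apply: op_norm_ub; rewrite normfZV.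
Qed.

Lemma op_normD (f g : bounded_op) : op_norm (f + g) <= op_norm f + op_norm g.
Proof.
apply: op_norm_le => x x1; rewrite /= (le_trans (ler_normD _ _))//.
by rewrite lerD// op_norm_ub.
Qed.

Lemma op_normZ (a : R) (f : bounded_op) : op_norm (a *: f) = `|a| * op_norm f.
Proof.
have le b h : op_norm (b *: h) <= `|b| * op_norm h.
  by apply: op_norm_le => x x1; rewrite /= normrZ ler_wpM2l// op_norm_ub.
have [->|a0] := eqVneq a 0.
  apply/eqP; rewrite eq_le le/= normr0 mul0r; exact: op_norm_ge0.
apply/eqP; rewrite eq_le le/= -ler_pdivlMl ?normr_gt0// -normfV.
by rewrite -{1}[f](scalerK a0) le.
Qed.

Lemma op_norm_eq0 (f : bounded_op) : op_norm f = 0 -> f = 0.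
Proof.
move=> f0; apply/val_inj/funext => x /=; apply/eqP; rewrite -normr_le0.
by rewrite (le_trans (op_normP f x))// f0 mul0r.
Qed.

HB.instance Definition _ :=
  Lmodule_isNormed.Build R bounded_op op_normD op_normZ op_norm_eq0.

Definition finite_rank (f : bounded_op) : Prop :=
  exists n (y : 'I_n -> Y),
    range f = [set \sum_(i < n) a i *: y i | a in [set: 'I_n -> R]].

End BoundedOperators.

Section BoundedOperatorsComplete.
Context {R : realType}.
Variables (X : normedModType R) (Y : completeNormedModType R).

Lemma bounded_op_complete (F : set_system (bounded_op X Y)) :
  ProperFilter F -> cauchy F -> cvg F.
Proof.
move=> FF Fc.
have Fball e : 0 < e ->
    exists2 f0 : bounded_op X Y, True & F [set f | `|f0 - f| < e].
  move=> e0; have /cauchyP/(_ _ e0)[f0] := Fc.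
  by rewrite -ball_normE => Ff0; exists f0.
have evc (x : X) : cvg ((f : bounded_op X Y) x @[f --> F]).
  apply: cauchy_cvg; apply/cauchyP => e e0.
  have d0 : 0 < e / (`|x| + 1) by rewrite divr_gt0// ltr_wpDl.
  have [f0 _ Ff0] := Fball _ d0; exists (f0 x).
  suff: F [set f : bounded_op X Y | ball (f0 x) e (f x)] by [].
  apply: filterS Ff0 => f /= Ff; rewrite -ball_normE /=.
  rewrite -[f0 x - f x]/((f0 - f) x) (le_lt_trans (op_normP (f0 - f) x))//.
  rewrite -[op_norm (f0 - f)]/(`|f0 - f|).
  have x1 : 0 < `|x| + 1 by rewrite ltr_wpDl.
  rewrite (@le_lt_trans _ _ (`|f0 - f| * (`|x| + 1)))//; last first.
    by rewrite -ltr_pdivlMr.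
  by rewrite ler_wpM2l// lerDl.
pose g (x : X) : Y := lim ((f : bounded_op X Y) x @[f --> F]).
have gE x : (f : bounded_op X Y) x @[f --> F] --> g x by exact: evc.
have lg : linear g.
  move=> a x y; apply: (cvg_lim (@norm_hausdorff _ _)).
  have -> : (fun f : bounded_op X Y => f (a *: x + y)) =
            (fun f : bounded_op X Y => a *: f x + f y).
    by apply/funext => f; rewrite linearP.
  by apply: cvgD; [apply: cvgZr; exact: gE|exact: gE].
have gclose (f0 : bounded_op X Y) e : F [set f | `|f0 - f| < e] ->
    forall x, `|f0 x - g x| <= e * `|x|.
  move=> Ff0 x.
  have cg : `|f0 x - (f : bounded_op X Y) x| @[f --> F] --> `|f0 x - g x|.
    by apply: cvg_norm; apply: cvgB; [exact: cvg_cst|exact: gE].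
  apply: (@closed_cvg _ _ F _ _ [set r : R | r <= e * `|x|]) cg.
    exact: closed_le.
  apply: filterS Ff0 => f /= Ff.
  rewrite -[f0 x - f x]/((f0 - f) x) (le_trans (op_normP (f0 - f) x))//.
  by rewrite ler_wpM2r// ltW.
have bg : g \in @bounded_linear R X Y.
  apply/asboolP; split=> //; have [f0 _ Ff0] := Fball 1 ltr01.
  exists (1 + `|f0|) => x.
  rewrite -[g x](subrKC (f0 x)) addrC mulrDl (le_trans (ler_normD _ _))//.
  by rewrite lerD ?op_normP// distrC gclose.
apply/cvg_ex; exists (BoundedOp bg); apply/cvgrPdist_le => e e0.
have [f0 _ Ff0] := Fball _ (divr_gt0 e0 (ltr0Sn R 1)).
apply: filterS (Ff0) => f /= Ff.
rewrite -(subrK f0 (BoundedOp bg)) -addrA (splitr e).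
rewrite (le_trans (ler_normD _ _))// lerD//; last exact: ltW.
apply: op_norm_le => x x1 /=; rewrite -[X in `|X|]opprB normrN.
rewrite -[X in `|X|]/(f0 x - g x).
rewrite (le_trans (gclose _ _ Ff0 x))// ler_piMr// ltW// divr_gt0//.
Qed.

HB.instance Definition _ :=
  Uniform_isComplete.Build (bounded_op X Y) bounded_op_complete.

End BoundedOperatorsComplete.

Notation dual_space Z := (bounded_op Z (GRing.regular _)).

Section Subspaces.
Context {R : realType} {V : normedModType R}.
Variable H : submodClosed V.

Record subspace_of := SubspaceOf {
  subspace_val :> V ;
  subspace_valP : subspace_val \in H }.

HB.instance Definition _ := [isSub for subspace_val].
HB.instance Definition _ := [Choice of subspace_of by <:].
HB.instance Definition _ := [SubChoice_isSubLmodule of subspace_of by <:].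

Let sub_norm (u : subspace_of) : R := `|subspace_val u|.

Let sub_normD (u v : subspace_of) : sub_norm (u + v) <= sub_norm u + sub_norm v.
Proof. exact: ler_normD. Qed.

Let sub_normZ (a : R) (u : subspace_of) : sub_norm (a *: u) = `|a| * sub_norm u.
Proof. exact: normrZ. Qed.

Let sub_norm_eq0 (u : subspace_of) : sub_norm u = 0 -> u = 0.
Proof. by move=> /normr0_eq0 u0; apply/val_inj. Qed.

HB.instance Definition _ :=
  Lmodule_isNormed.Build R subspace_of sub_normD sub_normZ sub_norm_eq0.

End Subspaces.

Section Roughness.
Context {R : realType}.
Implicit Types (Z : normedModType R) (delta : R).

(* sigma(Z^*, Z) is the topology of pointwise convergence on Z; the norm
   topology stays the canonical one on [dual_space Z]. *)
Definition weak_star Z : Type :=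
  initial_topology (fun f : dual_space Z => (f : {ptws Z -> R^o})).

HB.instance Definition _ Z := Topological.on (weak_star Z).

Definition norm_diameter Z (A : set Z) : \bar R :=
  ereal_sup [set `|u.1 - u.2|%:E | u in A `*` A].

Definition weakly_average_rough Z delta : Prop :=
  forall V : set (dual_space Z), open (V : set (weak_star Z)) ->
    let U := V `&` [set f : dual_space Z | `|f| <= 1] in
    U !=set0 -> (delta%:E <= norm_diameter U)%E.

(* The deleted neighbourhood filter takes care of the restriction y != 0. *)
Definition rough Z delta : Prop :=
  forall z : Z, `|z| = 1 ->
    (delta%:E <=
      limf_esup (fun y : Z => ((`|z + y| + `|z - y| - 2) / `|y|)%:E) (0%R : Z)^')%E.

Definition non_rough Z : Prop :=
  ~ exists2 epsilon : R, 0 < epsilon & rough Z epsilon.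

End Roughness.

(* Main.v *)
Require Import Defs.
From mathcomp Require Import all_boot all_order all_algebra.
From mathcomp Require Import all_classical all_reals all_analysis.
From mathcomp Require Import ring lra.

Import Order.TTheory GRing.Theory Num.Theory.
Import numFieldNormedType.Exports.

Local Open Scope classical_set_scope.
Local Open Scope ring_scope.

(* Both halves are one statement about two dual pairs, (P, E) for the target and
   (Q, A) for the non-rough side: (Y, Y^* ) and (X^*, X) in (a), (X^*, X) and
   (Y, Y^* ) in (b). An operator T acts on A x E as a bilinear form b_T, and the
   elements q (x) p are rank-one operators. Since Q is non-rough, some q in its
   sphere nearly strongly exposes a point a0 of the ball of A. If a functional h in
   the ball of H^* satisfies h (q (x) p0) > 1 - k for some p0 in the ball of P, then
   in an approximation of h by convex combinations of the functionals b_(.) a e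
   almost all the mass lies on points a close to a0, so that h is nearly
   b_(.) a0 e for some e in the ball of E, with <p, e> nearly h (q (x) p). Two far
   apart functionals in a weak^* neighbourhood of b_(.) a0 e0, with |e0| = 1, hence
   yield two far apart points of the ball of E in a prescribed weak neighbourhood
   of e0. A point with |e0| < 1 is moved to the sphere along a direction
   annihilated by the finitely many elements of P at hand; if there is none, E is
   finite-dimensional, and the conclusion on the sphere is absurd. *)

(** * Linear forms given as bare functions *)

Section LinearForms.
Context {R : realType} {V : lmodType R}.

Lemma linear_form0 (k : V -> R) : linear (k : V -> R^o) -> k 0 = 0.
Proof. by move=> lk; have := lk (-1) 0 0; rewrite !scaleN1r oppr0 addr0 addNr. Qed.

Lemma linear_formZ (k : V -> R) a v : linear (k : V -> R^o) -> k (a *: v) = a * k v.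
Proof. by move=> lk; have := lk a v 0; rewrite addr0 (linear_form0 _ lk) addr0. Qed.

Lemma linear_formD (k : V -> R) u v : linear (k : V -> R^o) -> k (u + v) = k u + k v.
Proof. by move=> lk; have := lk 1 u v; rewrite !scale1r. Qed.

Lemma linear_formN (k : V -> R) v : linear (k : V -> R^o) -> k (- v) = - k v.
Proof. by move=> lk; rewrite -scaleN1r linear_formZ// mulN1r. Qed.

Lemma linear_formB (k : V -> R) u v : linear (k : V -> R^o) -> k (u - v) = k u - k v.
Proof. by move=> lk; rewrite linear_formD// linear_formN. Qed.

Lemma linear_form_sum (k : V -> R) (s : seq V) (c : V -> R) :
  linear (k : V -> R^o) -> k (\sum_(v <- s) c v *: v) = \sum_(v <- s) c v * k v.
Proof.
move=> lk; elim/big_ind2: _ => [|u a v b <- <-|v _].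
- exact: linear_form0.
- exact: linear_formD.
- exact: linear_formZ.
Qed.

End LinearForms.

(** * Sublinear functionals and the Hahn-Banach theorem *)

Section HahnBanach.
Context {R : realType} {V : lmodType R}.
Implicit Types (p q : V -> R) (x y : V) (t : R).

(** Homogeneity is asked only as an inequality, which passes easily to infima; scaling back by the
    inverse turns it into an equality. *)
Definition sublinear p : Prop :=
  (forall x y, p (x + y) <= p x + p y) /\
  (forall t x, 0 < t -> p (t *: x) <= t * p x).

Lemma sublinear0 p : sublinear p -> p 0 = 0.
Proof.
move=> [pD pZ]; have := pD 0 0; have := pZ 2^-1 0 ltac:(lra).
rewrite addr0 scaler0; lra.
Qed.

Lemma sublinearN p x : sublinear p -> - p (- x) <= p x.
Proof. by move=> sp; have := sp.1 x (- x); rewrite subrr sublinear0//; lra. Qed.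

Lemma sublinearZ p t x : sublinear p -> 0 <= t -> p (t *: x) = t * p x.
Proof.
move=> sp; rewrite le_eqVlt => /predU1P[<-|t0].
  by rewrite scale0r mul0r sublinear0.
apply/eqP; rewrite eq_le sp.2//= -ler_pdivlMl//.
by rewrite -[in leLHS](scalerK (lt0r_neq0 t0) x) sp.2// invr_gt0.
Qed.

(** Oddness gives the missing half of additivity: [p x <= p (x + y) + p (- y) = p (x + y) - p y]. *)
Lemma sublinear_linear p : sublinear p -> (forall y, p (- y) <= - p y) ->
  linear (p : V -> R^o).
Proof.
move=> sp pN.
have pNE y : p (- y) = - p y.
  by apply/eqP; rewrite eq_le pN/= lerNl sublinearN.
have pD x y : p (x + y) = p x + p y.
  apply/eqP; rewrite eq_le sp.1/=.
  by have := sp.1 (x + y) (- y); rewrite addrK pNE; lra.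
move=> a x y; rewrite pD; congr (_ + _).
have [a0|a0] := leP 0 a; first exact: sublinearZ.
rewrite -[a in LHS]opprK scaleNr pNE sublinearZ//; last lra.
by rewrite /GRing.scale/=; lra.
Qed.

(** Infimal convolution of [p] with the function sending [- t *: y] to [- t * p y] for [t >= 0]. It
    stays sublinear and below [p], while its value at [- y] drops to at most [- p y]. *)
Definition sub_lower p y x : R := inf [set p (x + t *: y) - t * p y | t in [set t | 0 <= t]].

Lemma sub_lower_has_inf p y x : sublinear p ->
  has_inf [set p (x + t *: y) - t * p y | t in [set t | 0 <= t]].
Proof.
move=> sp; split; first by exists (p (x + 0 *: y) - 0 * p y); exists 0 => /=.
exists (- p (- x)) => _ [t /= t0 <-].
have := sp.1 (- x) (x + t *: y); rewrite addKr sublinearZ//; lra.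
Qed.

Lemma sub_lower_le p y x t : sublinear p -> 0 <= t ->
  sub_lower p y x <= p (x + t *: y) - t * p y.
Proof.
move=> sp t0; apply: ge_inf; last by exists t.
by case: (sub_lower_has_inf p y x sp).
Qed.

Lemma sub_lower_ge p y x c : sublinear p ->
  (forall t, 0 <= t -> c <= p (x + t *: y) - t * p y) -> c <= sub_lower p y x.
Proof.
move=> sp h; apply: lb_le_inf; first by case: (sub_lower_has_inf p y x sp).
by move=> _ [t /= t0 <-]; exact: h.
Qed.

Lemma sub_lower_sublinear p y : sublinear p -> sublinear (sub_lower p y).
Proof.
move=> sp; split=> [x x'|s x s0].
  rewrite -lerBlDr; apply: sub_lower_ge => // t t0.
  rewrite lerBlDr -lerBlDl; apply: sub_lower_ge => // t' t'0.
  have := sub_lower_le p y (x + x') (t + t') sp (addr_ge0 t0 t'0).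
  have := sp.1 (x + t *: y) (x' + t' *: y).
  by rewrite scalerDl addrACA; lra.
rewrite -ler_pdivrMl//; apply: sub_lower_ge => // t t0.
rewrite ler_pdivrMl// mulrBr mulrA -sublinearZ ?(ltW s0)// scalerDr scalerA.
by apply: sub_lower_le => //; rewrite mulr_ge0// ltW.
Qed.

Lemma sub_lower_leq p y x : sublinear p -> sub_lower p y x <= p x.
Proof.
by move=> sp; have := sub_lower_le p y x 0 sp (lexx _); rewrite scale0r mul0r addr0 subr0.
Qed.

Lemma sub_lowerN p y : sublinear p -> sub_lower p y (- y) <= - p y.
Proof.
move=> sp; have := sub_lower_le p y (- y) 1 sp ler01.
by rewrite scale1r mul1r addNr sublinear0// sub0r.
Qed.

(** The infimum is finite because every member is at least [- q (- x)] at [x]. It is subadditive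
    because, of two members of a chain, the smaller one can serve at both points. *)
Lemma chain_inf_sublinear q (A : set (V -> R)) : A !=set0 ->
  (forall p, A p -> sublinear p /\ forall x, p x <= q x) ->
  (forall p p', A p -> A p' -> (forall x, p x <= p' x) \/ (forall x, p' x <= p x)) ->
  let m x := inf [set p x | p in A] in
  sublinear m /\ forall p x, A p -> m x <= p x.
Proof.
move=> [p0 Ap0] Aq totA m.
have mle p x : A p -> m x <= p x.
  move=> Ap; apply: ge_inf; last by exists p.
  exists (- q (- x)) => _ [p' Ap' <-]; have [sp' p'q] := Aq _ Ap'.
  by rewrite (le_trans _ (sublinearN _ _ sp'))// lerN2 p'q.
have mge c x : (forall p, A p -> c <= p x) -> c <= m x.
  move=> h; apply: lb_le_inf; first by exists (p0 x); exists p0.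
  by move=> _ [p Ap <-]; exact: h.
split=> [|p x]; last exact: mle.
split=> [x y|t x t0].
  rewrite -lerBlDr; apply: (mge) => p Ap; rewrite lerBlDr -lerBlDl.
  apply: (mge) => p' Ap'; rewrite lerBlDl.
  have [pp'|p'p] := totA _ _ Ap Ap'.
    apply: le_trans (mle _ _ Ap) _; have := (Aq _ Ap).1.1 x y; have := pp' y; lra.
  apply: le_trans (mle _ _ Ap') _; have := (Aq _ Ap').1.1 x y; have := p'p x; lra.
rewrite -ler_pdivrMl//; apply: (mge) => p Ap; rewrite ler_pdivrMl//.
exact: le_trans (mle _ _ Ap) ((Aq _ Ap).1.2 _ _ t0).
Qed.

(* A minimal sublinear functional is linear, so no partially defined
   functionals need to be extended. *)
Lemma hahn_banach q : sublinear q ->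
  exists2 f : V -> R, linear (f : V -> R^o) & forall x, f x <= q x.
Proof.
move=> sq; pose T := {p : V -> R | sublinear p /\ forall x, p x <= q x}.
(* The order is reversed, so that a maximal element for Zorn's lemma is a pointwise minimal
   functional. *)
pose below (p p' : T) := `[< forall x, sval p' x <= sval p x >].
have [||A totA|[p [sp pq]] pmin] :=
    @ZL_preorder T (exist _ q (conj sq (fun x => lexx (q x)))) below.
- by move=> t; apply/asboolP.
- by move=> r s t /asboolP rs /asboolP st; apply/asboolP => x; exact: le_trans (rs x).
- have [[t At]|A0] := pselect (A !=set0); last first.
    by exists (exist _ q (conj sq (fun x => lexx (q x)))) => s As; case: A0; exists s.
  have [|||sm mle] := @chain_inf_sublinear q [set sval p | p in A].
  + by exists (sval t); exists t.
  + by move=> _ [p _ <-]; exact: svalP p.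
  + move=> _ _ [p Ap <-] [p' Ap' <-].
    by have [/asboolP|/asboolP] := totA _ _ Ap Ap'; [right|left].
  have mq x : inf [set p x | p in [set sval p | p in A]] <= q x.
    by apply: le_trans (mle (sval t) x _) _; [exists t|exact: (svalP t).2].
  exists (exist (fun p => sublinear p /\ forall x, p x <= q x) _ (conj sm mq)).
  move=> s As; apply/asboolP => x /=; by apply: mle; exists s.
exists p => //; apply: sublinear_linear => // y.
have sl := sub_lower_sublinear p y sp.
have slq x : sub_lower p y x <= q x := le_trans (sub_lower_leq p y x sp) (pq x).
(* By minimality [p] lies below its own lowering along [y], which at [- y] is at most [- p y]; hence
   [p] is odd. *)
have /pmin/asboolP/(_ (- y))/= : below (exist _ p (conj sp pq))
    (exist (fun p => sublinear p /\ forall x, p x <= q x) _ (conj sl slq)).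
  by apply/asboolP => x; exact: sub_lower_leq.
by move=> /le_trans; apply; exact: sub_lowerN.
Qed.

End HahnBanach.

(** * Norming functionals in the dual ball *)

Lemma norm_sublinear {R : realType} (Z : normedModType R) :
  sublinear (fun z : Z => `|z|).
Proof. by split=> [x y|t x t0]; rewrite ?ler_normD// normrZ gtr0_norm. Qed.

Lemma dual_space_of_form {R : realType} (Z : normedModType R) (f : Z -> R) :
  linear (f : Z -> R^o) -> (forall z, `|f z| <= `|z|) ->
  exists2 g : dual_space Z, `|g| <= 1 & forall z, g z = f z.
Proof.
move=> lf fb; have bf : (f : Z -> R^o) \in @bounded_linear R Z R^o.
  by apply/asboolP; split=> //; exists 1 => z; rewrite mul1r.
exists (BoundedOp bf) => //; apply: op_norm_le => z z1.
exact: le_trans (fb z) z1.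
Qed.

(** Hahn-Banach is applied to the norm lowered along [z]: a linear form below it satisfies
    [f (- z) <= - |z|], so it attains the norm at [z]. *)
Lemma norming_functional {R : realType} (Z : normedModType R) (z : Z) :
  exists2 f : dual_space Z, `|f| <= 1 & f z = `|z|.
Proof.
pose N (z : Z) := `|z|; have sN : sublinear N := norm_sublinear Z.
have [f lf fq] := hahn_banach _ (sub_lower_sublinear N z sN).
have fN x : f x <= `|x| := le_trans (fq x) (sub_lower_leq N z x sN).
have fNE x : f (- x) = - f x := linear_formN _ _ lf.
have fb x : `|f x| <= `|x| by rewrite ler_norml fN lerNl -fNE -(normrN x) fN.
have [g g1 gE] := dual_space_of_form _ f lf fb; exists g => //; rewrite gE.
apply/eqP; rewrite eq_le fN/= -[f z]opprK -fNE lerNr.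
exact: le_trans (fq _) (sub_lowerN _ _ sN).
Qed.

(** * Basic weak-star neighbourhoods and roughness in terms of them *)

Section WeakStar.
Context {R : realType}.
Implicit Types Z : normedModType R.

Definition weak_star_basic {Z} (f : dual_space Z) (s : seq Z) (eta : R) :
  set (dual_space Z) := [set g | forall z, z \in s -> `|g z - f z| < eta].

Lemma weak_star_basic_open Z (f : dual_space Z) s eta :
  open (weak_star_basic f s eta : set (weak_star Z)).
Proof.
elim: s => [|z s IH].
  by rewrite (_ : weak_star_basic _ _ _ = setT); [exact: openT|exact/seteqP].
rewrite (_ : weak_star_basic _ _ _ =
  (fun g : weak_star Z => (g : dual_space Z) z : R^o) @^-1` ball (f z : R^o) eta
  `&` weak_star_basic f s eta); last first.
  apply/seteqP; split=> [g h|g [h1 h2] z' /=].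
    split; last by move=> z' z's; apply: h; rewrite in_cons z's orbT.
    by rewrite /preimage/= -ball_normE/= distrC; apply: h; rewrite in_cons eqxx.
  rewrite in_cons => /orP[/eqP->|]; last exact: h2.
  by move: h1; rewrite /preimage/= -ball_normE/= distrC.
apply: openI => //; apply: open_comp; last exact: ball_open.
move=> g _.
apply: (@continuous_comp _ _ _ (fun g : weak_star Z => (g : {ptws Z -> R^o}))
   (fun h : {ptws Z -> R^o} => h z)).
  exact: initial_continuous.
exact: proj_continuous.
Qed.

Lemma weak_star_basic_sub Z (f : dual_space Z) (V : set (dual_space Z)) :
  open (V : set (weak_star Z)) -> V f ->
  exists s, exists2 eta, 0 < eta & weak_star_basic f s eta `<=` V.
Proof.
move=> [A oA <-] Af.
(* The sets containing a basic neighbourhood of [f] form a filter that converges pointwise to [f],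
   so this filter contains every open set around [f]. *)
pose F : set_system {ptws Z -> R^o} := [set B | exists s, exists2 eta, 0 < eta &
  forall g, weak_star_basic f s eta g -> B (g : Z -> R^o)].
have FF : Filter F.
  split=> [|B C [s [e e0 sB]] [s' [e' e'0 sC]]|B C BC [s [e e0 sB]]].
  - by exists nil; exists 1.
  - exists (s ++ s'); exists (Num.min e e'); first by rewrite lt_min e0.
    move=> g gs; split; [apply: sB|apply: sC] => z zs;
      have := gs z; rewrite mem_cat zs ?orbT => /(_ isT);
      by rewrite lt_min => /andP[].
  - by exists s; exists e => // g /sB; exact: BC.
suff : F A by [].
have : F --> (f : {ptws Z -> R^o}).
  apply/pointwise_cvgP => z B /nbhs_ballP[e /= e0 eB].
  exists [:: z]; exists e => // g /(_ z (mem_head _ _)) gz.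
  by apply: eB; rewrite -ball_normE /= distrC.
by apply; exact: open_nbhs_nbhs.
Qed.

(** The diameter is a supremum that need not be attained; letting [delta'] range below [delta]
    replaces it by explicit pairs of functionals, and basic neighbourhoods replace open sets. *)
Lemma weakly_average_roughP Z (delta : R) : weakly_average_rough Z delta <->
  forall (h : dual_space Z) (s : seq Z) (eta delta' : R), `|h| <= 1 -> 0 < eta ->
    delta' < delta -> exists h1 h2 : dual_space Z,
    [/\ `|h1| <= 1 /\ `|h2| <= 1, weak_star_basic h s eta h1,
        weak_star_basic h s eta h2 & delta' < `|h1 - h2| ].
Proof.
split=> [rZ h s eta d' h1 eta0 d'd|rZ V oV U [h [Vh h1]]].
  have /= := rZ _ (weak_star_basic_open _ h s eta).
  move=> /(_ _)/(lt_le_trans _) r; have {r} : (d'%:E < norm_diameter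
      (weak_star_basic h s eta `&` [set f : dual_space Z | (`|f| <= 1)%R]))%E.
    apply: r; rewrite ?lte_fin//.
    by exists h; split=> // z _; rewrite subrr normr0.
  move=> /ereal_sup_gt[_ [[g1 g2] /= [[b1 n1] [b2 n2]] <-]]; rewrite lte_fin => d'g.
  by exists g1, g2.
have [s [eta eta0 sV]] := weak_star_basic_sub _ h V oV Vh.
apply/lee_subgt0Pr => e e0; rewrite -EFinB.
have d'd : delta - e < delta by lra.
have [g1 [g2 [[n1 n2] b1 b2 d'g]]] := rZ h s eta _ h1 eta0 d'd.
apply: (@le_trans _ _ (`|g1 - g2|%:E)); first by rewrite lee_fin ltW.
by apply: ereal_sup_ubound; exists (g1, g2) => //; split; split => //; exact: sV.
Qed.

End WeakStar.

(** * A Goldstine theorem for convex norming sets of functionals *)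

Section Goldstine.
Context {R : realType} {V : normedModType R}.

(* Least squares: if the distance from [h] to [K] on [s] were positive, then the
   element of [K] nearly norming the gradient direction would give a uniform
   improvement. *)
Lemma goldstine (K : set (V -> R)) (h : V -> R) (s : seq V) (eta : R) :
  (forall k, K k -> linear (k : V -> R^o) /\ forall v, `|k v| <= `|v|) ->
  (forall k k' t, K k -> K k' -> 0 <= t <= 1 ->
    K (fun v => (1 - t) * k v + t * k' v)) ->
  (forall v e, 0 < e -> exists2 k, K k & `|v| - e <= k v) ->
  linear (h : V -> R^o) -> (forall v, h v <= `|v|) -> 0 < eta ->
  exists2 k, K k & forall v, v \in s -> `|h v - k v| < eta.
Proof.
move=> Klin Kconv Knorm lh hb eta0; apply: contrapT => noK.
pose D k := \sum_(v <- s) (h v - k v) ^+ 2.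
pose d := inf [set D k | k in K].
have D0 k : 0 <= D k by apply: sumr_ge0 => v _; exact: sqr_ge0.
have [k0 Kk0 _] := Knorm 0 1 ltr01.
have dD k : K k -> d <= D k.
  move=> Kk; apply: ge_inf; last by exists k.
  by exists 0 => _ [k' _ <-].
have dge c : (forall k, K k -> c <= D k) -> c <= d.
  move=> cD; apply: lb_le_inf; first by exists (D k0); exists k0.
  by move=> _ [k Kk <-]; exact: cD.
have d0 : 0 < d.
  apply: (@lt_le_trans _ _ (eta ^+ 2)); first by rewrite exprn_gt0.
  apply: dge => k Kk; rewrite leNgt; apply/negP => Dk; apply: noK.
  exists k => // v vs; rewrite -(@ltr_pXn2r _ 2)// ?nnegrE ?ltW//.
  rewrite real_normK ?num_real//; apply: le_lt_trans Dk.
  by rewrite /D (big_rem v)//= lerDl sumr_ge0// => u _; exact: sqr_ge0.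
(* [B] bounds the quadratic term of [D] along any segment in [K], since two members of [K] differ at
   [v] by at most twice the norm of [v]. *)
pose B := \sum_(v <- s) (2 * `|v|) ^+ 2.
have B0 : 0 <= B by apply: sumr_ge0 => v _; exact: sqr_ge0.
(* With this [t], [t * B <= d / 2]: the quadratic loss is at most [t * d / 2], while the linear gain
   is at least [2 * t * (D k - d / 2)]. The net decrease is at least [t * d / 2]. *)
have [t [t0 t1 tE]] : exists t, [/\ 0 < t, t <= 1 & t * (d + 2 * B) = d].
  exists (d / (d + 2 * B)); split; last by rewrite mulfVK//; lra.
    by apply: divr_gt0 => //; lra.
  by rewrite ler_pdivrMr; lra.
suff : d + t * d / 2 <= d by have := mulr_gt0 t0 d0; lra.
apply: dge => k Kk.
pose w := \sum_(v <- s) (h v - k v) *: v.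
have [k' Kk' k'w] := Knorm w (d / 2) ltac:(lra).
have [lk kb] := Klin _ Kk; have [lk' k'b] := Klin _ Kk'.
pose X := \sum_(v <- s) (h v - k v) * (k' v - k v).
have XE : X = k' w - k w.
  rewrite !linear_form_sum// -sumrB; apply: eq_bigr => v _; ring.
have DE : D k = h w - k w.
  rewrite !linear_form_sum// -sumrB; apply: eq_bigr => v _; ring.
pose Y := \sum_(v <- s) (k' v - k v) ^+ 2.
have YB : Y <= B.
  apply: ler_sum => v _; rewrite -real_normK ?num_real// ler_pXn2r// ?nnegrE ?mulr_ge0//.
  by rewrite (le_trans (ler_normB _ _))//; have := kb v; have := k'b v; lra.
have /dD : K (fun v => (1 - t) * k v + t * k' v) by apply: Kconv => //; lra.
have -> : D (fun v => (1 - t) * k v + t * k' v) = D k - 2 * t * X + t ^+ 2 * Y.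
  rewrite /D /X /Y !mulr_sumr -sumrB -big_split/=; apply: eq_bigr => v _; ring.
have := dD _ Kk; have := hb w => hw dDk dt.
(* [k'] norms [w] up to [d / 2] and [h w] is at most the norm of [w], so [k' w] is at least
   [h w - d / 2]. *)
have XD : D k - d / 2 <= X by lra.
have : t * (D k - d / 2) <= t * X by rewrite ler_wpM2l// ltW.
have : t * (t * Y) <= t * (d / 2).
  rewrite ler_wpM2l ?ltW//.
  have : t * Y <= t * B by rewrite ler_wpM2l// ltW.
  have : 0 <= t * d by rewrite mulr_ge0// ltW.
  nra.
have : t * d <= t * D k by rewrite ler_wpM2l// ltW.
lra.
Qed.
End Goldstine.

(** * Dual pairs of normed spaces *)

(** Each space embeds isometrically into the dual of the other. The notion is symmetric and does not
    ask that [E] be the whole dual of [P], so it covers a space with its dual in either order. *)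
Definition norming_pairing {R : realType} {P E : normedModType R}
    (f : P -> E -> R) : Prop :=
  [/\ forall e, linear (f^~ e : P -> R^o),
      forall p, linear (f p : E -> R^o),
      forall p e, `|f p e| <= `|p| * `|e|,
      forall p eta, 0 < eta -> exists2 e, `|e| <= 1 & `|p| - eta <= f p e
    & forall e eta, 0 < eta -> exists2 p, `|p| <= 1 & `|e| - eta <= f p e].

Section Pairing.
Context {R : realType} {P E : normedModType R} (f : P -> E -> R).
Hypothesis fP : norming_pairing f.

Lemma pairing_le_norm p e : `|e| <= 1 -> `|f p e| <= `|p|.
Proof. by case: fP => _ _ fb _ _ e1; rewrite (le_trans (fb p e))// ler_piMr. Qed.

Lemma pairing_norm_le e c : (forall p, `|p| <= 1 -> f p e <= c) -> `|e| <= c.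
Proof.
case: fP => _ _ _ _ fE fc; apply/ler_addgt0Pr => eta eta0.
have [p p1] := fE e eta eta0; have := fc p p1; lra.
Qed.

(** A Smulyan-type duality. At a point [z] where roughness fails,
    [|z + y| + |z - y| <= 2 + eps * |y|] for [|y| = r / 2]. Since [f y (a - a')] equals [f (z + y) a
    + f (z - y) a' - f z a - f z a'], it is at most [eps * (r / 2)] plus the deficiency of [a] and
    [a'] at [z]; dividing by [r / 2] gives [C = 2 / r]. *)
Lemma non_rough_strongly_exposing (eps : R) : non_rough P -> 0 < eps ->
  exists q C, [/\ `|q| = 1, 0 <= C & forall a a', `|a| <= 1 -> `|a'| <= 1 ->
    `|a - a'| <= eps + C * (2 - f q a - f q a')].
Proof.
move=> nr eps0; have {}nr : ~ rough P eps by move=> r; apply: nr; exists eps.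
have [z nz] : exists z, ~ (`|z| = 1 -> (eps%:E <=
    limf_esup (fun y : P => ((`|z + y| + `|z - y| - 2) / `|y|)%:E) (0%R : P)^')%E).
  by apply/existsNP.
move: nz => /not_implyP[z1 /negP]; rewrite -ltNge limf_esupE.
move=> /ereal_inf_lt[_ [W W0 <-]] supW.
have [r r0 rW] : exists2 r : R, 0 < r & forall y : P, `|y| < r -> y != 0 -> W y.
  move: W0 => /nbhs_ballP[r /= r0 rW]; exists r => // y yr.
  by apply: rW; rewrite -ball_normE /= sub0r normrN.
have r2 : 0 < r / 2 by lra.
have zy y : `|y| = r / 2 -> `|z + y| + `|z - y| <= 2 + eps * (r / 2).
  move=> yr; have Wy : W y.
    by apply: rW; [rewrite yr; lra|rewrite -normr_gt0 yr].
  have : (((`|z + y| + `|z - y| - 2) / `|y|)%:E < eps%:E)%E.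
    by apply: le_lt_trans supW; apply: ereal_sup_ubound; exists y.
  by rewrite lte_fin yr ltr_pdivrMr//; lra.
exists z, (2 / r); split=> // [|a a' a1 a'1]; first by rewrite divr_ge0// ltW.
case: (fP) => fl fr fb _ _.
set X := 2 - f z a - f z a'.
have X0 : 0 <= X.
  have := pairing_le_norm z _ a1; have := pairing_le_norm z _ a'1.
  by rewrite z1 !ler_norml /X => /andP[_ ?] /andP[_ ?]; lra.
have bound0 : 0 <= eps + 2 / r * X.
  by rewrite addr_ge0 ?(ltW eps0)// mulr_ge0// divr_ge0// ltW.
apply: pairing_norm_le => p p1.
have [->|p0] := eqVneq p 0; first by rewrite (linear_form0 _ (fl _)).
have [n np np0] : exists2 n : R, n = `|p| & 0 < n by exists `|p|; rewrite ?normr_gt0.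
have [c c0 cn] : exists2 c : R, 0 < c & c * n = r / 2.
  by exists (r / 2 / n); rewrite ?divr_gt0// mulfVK// gt_eqF.
pose y := c *: p.
have yr : `|y| = r / 2 by rewrite -cn np -[X in X * _](gtr0_norm c0); exact: normrZ.
have fy : f y (a - a') <= eps * (r / 2) + X.
  have -> : f y (a - a') = f (z + y) a + f (z - y) a' - f z a - f z a'.
    rewrite (linear_formB _ a a' (fr y)) (linear_formD _ z y (fl a)).
    rewrite (linear_formB _ z y (fl a')); ring.
  have := le_trans (ler_norm _) (pairing_le_norm (z + y) _ a1).
  have := le_trans (ler_norm _) (pairing_le_norm (z - y) _ a'1).
  have := zy _ yr; rewrite /X; lra.
apply: le_trans (_ : (eps + 2 / r * X) * n <= _); last by rewrite ler_piMr// np.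
rewrite -(ler_pM2l c0) -(linear_formZ _ _ _ (fl _)) (le_trans fy)//.
suff -> : c * ((eps + 2 / r * X) * n) = eps * (r / 2) + X by [].
by rewrite mulrCA cn; field; rewrite (gt_eqF r0).
Qed.

(** Induction on [s]: a new [p] either vanishes on the annihilator found so far, or equals 1 at some
    [v] in it, and [z] is corrected by a multiple of [v]. If the annihilator is trivial, the values
    on [s] control the norm of [E]. *)
Lemma annihilator_dist (s : seq P) : exists2 C, 0 <= C & forall e, exists2 z,
  forall p, p \in s -> f p z = 0 & `|e - z| <= C * \sum_(p <- s) `|f p e|.
Proof.
case: fP => _ fl fb _ _.
elim: s => [|p s [C C0 IH]].
  by exists 0 => // e; exists e => //; rewrite subrr normr0 mul0r.
have [h|] := pselect (forall z, (forall p, p \in s -> f p z = 0) -> f p z = 0).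
  exists C => // e; have [z zs ez] := IH e; exists z.
    by move=> p'; rewrite in_cons => /orP[/eqP->|]; [exact: h|exact: zs].
  by rewrite big_cons (le_trans ez)// ler_wpM2l// lerDr.
move=> /existsNP[u /not_implyP[us /eqP pu]].
pose v := (f p u)^-1 *: u.
have pv : f p v = 1 by rewrite linear_formZ// mulVf.
have vs p' : p' \in s -> f p' v = 0.
  by move=> /us p'u; rewrite linear_formZ// p'u mulr0.
exists (C + (1 + `|p| * C) * `|v|).
  by rewrite addr_ge0// mulr_ge0// addr_ge0// mulr_ge0.
move=> e; have [z zs ez] := IH e; exists (z - f p z *: v).
  move=> p'; rewrite in_cons => /orP[/eqP->|p's].
    by rewrite linear_formB// linear_formZ// pv mulr1 subrr.
  by rewrite linear_formB// linear_formZ// vs// mulr0 zs// subr0.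
rewrite big_cons; set S := \sum_(p <- s) `|f p e| in ez *.
have S0 : 0 <= S by apply: sumr_ge0.
have fpz : `|f p z| <= `|f p e| + `|p| * (C * S).
  have -> : f p z = f p e - f p (e - z) by rewrite linear_formB//; ring.
  rewrite (le_trans (ler_normB _ _))// lerD2l (le_trans (fb _ _))//.
  by rewrite ler_wpM2l.
rewrite opprB addrCA addrC (le_trans (ler_normD _ _))// normrZ.
have h1 : `|f p z| * `|v| <= (`|f p e| + `|p| * (C * S)) * `|v| by rewrite ler_wpM2r.
have h2 : 0 <= C * `|f p e| by rewrite mulr_ge0.
have h3 : 0 <= S * `|v| by rewrite mulr_ge0.
have h4 : 0 <= `|p| * C * `|f p e| * `|v| by rewrite !mulr_ge0.
lra.
Qed.

End Pairing.

(** * Auxiliary estimates on scalars, balls and dual norms *)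

Lemma exists_small {R : realFieldType} (a b x y : R) : 0 < x -> 0 < y ->
  0 <= a -> 0 <= b -> exists k, [/\ 0 < k, k <= 1, a * k < x & b * k <= y].
Proof.
move=> x0 y0 a0 b0; pose u := x / (2 * a + x); pose v := y / (b + y).
have u0 : 0 < u by apply: divr_gt0 => //; lra.
have v0 : 0 < v by apply: divr_gt0 => //; lra.
have u1 : u <= 1 by rewrite ler_pdivrMr; lra.
have au : a * u < x.
  by rewrite /u mulrA ltr_pdivrMr; [nra|lra].
have bv : b * v <= y.
  by rewrite /v mulrA ler_pdivrMr; [nra|lra].
exists (Num.min u v); split.
- by rewrite lt_min u0.
- by rewrite ge_min u1.
- by apply: le_lt_trans au; rewrite ler_wpM2l// ge_min lexx.
- by apply: le_trans bv; rewrite ler_wpM2l// ge_min lexx orbT.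
Qed.

Lemma norm_convex_comb {R : realFieldType} (t x y a b : R) : 0 <= t <= 1 ->
  `|x| <= a -> `|y| <= b -> `|(1 - t) * x + t * y| <= (1 - t) * a + t * b.
Proof.
move=> /andP[t0 t1] xa yb; rewrite (le_trans (ler_normD _ _))// !normrM.
by rewrite (ger0_norm t0) ger0_norm ?subr_ge0// lerD// ler_wpM2l// subr_ge0.
Qed.

Lemma convex_ball {R : realType} {E : normedModType R} (t : R) (x y : E) :
  0 <= t <= 1 -> `|x| <= 1 -> `|y| <= 1 -> `|(1 - t) *: x + t *: y| <= 1.
Proof.
move=> /andP[t0 t1] x1 y1; rewrite (le_trans (ler_normD _ _))// !normrZ.
rewrite (ger0_norm t0) ger0_norm ?subr_ge0//.
have : (1 - t) * `|x| <= (1 - t) * 1 by rewrite ler_wpM2l// subr_ge0.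
have : t * `|y| <= t * 1 by rewrite ler_wpM2l.
by rewrite !mulr1 => h1 h2; rewrite (le_trans (lerD h2 h1))// subrK.
Qed.

Lemma dual_norm_adherent {R : realType} (Z : normedModType R) (h : dual_space Z) c :
  c < `|h| -> exists2 z : Z, `|z| <= 1 & c < h z.
Proof.
move=> ch; apply: contrapT => noz; have hc z : `|z| <= 1 -> h z <= c.
  by move=> z1; rewrite leNgt; apply/negP => cz; apply: noz; exists z.
suff : `|h| <= c by rewrite leNgt ch.
apply: op_norm_le => z z1; rewrite ler_norml hc// andbT lerNl.
by rewrite -[X in X <= _](linear_formN _ _ (bounded_op_linear h)) hc// normrN.
Qed.

(** * Transfer of roughness from a space of bilinear forms to one factor *)

Section Transfer.
Context {R : realType} {P E Q A V : normedModType R}.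
Variables (pe : P -> E -> R) (qa : Q -> A -> R).
Variables (b : V -> A -> E -> R) (tens : Q -> P -> V).
Hypothesis peP : norming_pairing pe.
Hypothesis qaP : norming_pairing qa.
Hypothesis bV : forall a e, linear (b ^~ a ^~ e : V -> R^o).
Hypothesis bA : forall T e, linear (b T ^~ e : A -> R^o).
Hypothesis bE : forall T a, linear (b T a : E -> R^o).
Hypothesis b_le : forall T a e, `|b T a e| <= `|T| * `|a| * `|e|.
Hypothesis b_norming : forall T eta, 0 < eta ->
  exists a e, [/\ `|a| <= 1, `|e| <= 1 & `|T| - eta <= b T a e].
Hypothesis b_tens : forall q p a e, b (tens q p) a e = qa q a * pe p e.

Lemma form_le T a e : `|a| <= 1 -> `|e| <= 1 -> `|b T a e| <= `|T|.
Proof.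
move=> a1 e1; rewrite (le_trans (b_le T a e))// -mulrA ler_piMr//.
by rewrite mulr_ile1.
Qed.

(* The functionals [k] on [V] that are, up to the deficiency [1 - m], of the
   form [b _ a0 e]. The conditions are convex in [(k, e, m)], and [m] is read off
   from the values of [k] on the elements [tens q p]. *)
Definition nearly_elementary (q : Q) (a0 : A) (eps C : R) (k : V -> R) : Prop :=
  [/\ linear (k : V -> R^o), forall T, `|k T| <= `|T| & exists e m,
    [/\ `|e| <= 1, 0 <= m <= 1,
        forall p, `|pe p e - k (tens q p)| <= (1 - m) * `|p|,
        forall p, `|k (tens q p)| <= m * `|p|
      & forall T, `|k T - b T a0 e| <= `|T| * (eps + C * (1 - m))] ].

Lemma nearly_elementary_convex q a0 eps C k k' t : 0 <= t <= 1 ->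
  nearly_elementary q a0 eps C k -> nearly_elementary q a0 eps C k' ->
  nearly_elementary q a0 eps C (fun T => (1 - t) * k T + t * k' T).
Proof.
move=> t01 [lk kb [e [m [e1 /andP[m0 m1] h1 h2 h3]]]]
  [lk' k'b [e' [m' [e'1 /andP[m'0 m'1] h1' h2' h3']]]].
case: (peP) => _ lpe _ _ _.
split=> [c T T'|T|].
- by rewrite lk lk' /GRing.scale/=; ring.
- apply: le_trans (norm_convex_comb _ _ _ _ _ t01 (kb T) (k'b T)) _; lra.
exists ((1 - t) *: e + t *: e'), ((1 - t) * m + t * m'); split.
- exact: convex_ball.
- case/andP: t01 => t0 t1.
  have : (1 - t) * m <= (1 - t) * 1 by rewrite ler_wpM2l// subr_ge0.
  have : t * m' <= t * 1 by rewrite ler_wpM2l.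
  by rewrite addr_ge0 ?mulr_ge0 ?subr_ge0//=; lra.
- move=> p; rewrite (linear_formD _ _ _ (lpe p)) !(linear_formZ _ _ _ (lpe p)).
  rewrite [X in `|X|](_ : _ = (1 - t) * (pe p e - k (tens q p)) +
    t * (pe p e' - k' (tens q p))); last ring.
  apply: le_trans (norm_convex_comb _ _ _ _ _ t01 (h1 p) (h1' p)) _; lra.
- move=> p; apply: le_trans (norm_convex_comb _ _ _ _ _ t01 (h2 p) (h2' p)) _; lra.
- move=> T; rewrite (linear_formD _ _ _ (bE T a0)) !(linear_formZ _ _ _ (bE T a0)).
  rewrite [X in `|X|](_ : _ = (1 - t) * (k T - b T a0 e) +
    t * (k' T - b T a0 e')); last ring.
  apply: le_trans (norm_convex_comb _ _ _ _ _ t01 (h3 T) (h3' T)) _; lra.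
Qed.

(** The parameter [m] is [qa q a], because the form takes the value [qa q a * pe p e] at
    [tens q p]. *)
Lemma nearly_elementary_form q a0 eps C a e : `|q| <= 1 ->
  (forall a, `|a| <= 1 -> `|a - a0| <= eps + C * (1 - qa q a)) ->
  `|a| <= 1 -> `|e| <= 1 -> 0 <= qa q a ->
  nearly_elementary q a0 eps C (fun T => b T a e).
Proof.
move=> q1 qexp a1 e1 qa0.
have qa1 : qa q a <= 1.
  exact: le_trans (ler_norm _) (le_trans (pairing_le_norm _ qaP q a a1) q1).
split=> [||]; [exact: bV|by move=> T; exact: form_le|].
exists e, (qa q a); split=> // [|p|p|T].
- by rewrite qa0.
- rewrite b_tens -[X in X - _]mul1r -mulrBl normrM ger0_norm ?subr_ge0//.
  by rewrite ler_wpM2l ?subr_ge0// (pairing_le_norm _ peP).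
- by rewrite b_tens normrM ger0_norm// ler_wpM2l// (pairing_le_norm _ peP).
- rewrite -(linear_formB _ a a0 (bA T e)) (le_trans (b_le _ _ _))// -mulrA.
  by rewrite ler_wpM2l// (le_trans _ (qexp a a1))// ler_piMr.
Qed.

Lemma nearly_elementary_norming q a0 eps C T eta : `|q| <= 1 ->
  (forall a, `|a| <= 1 -> `|a - a0| <= eps + C * (1 - qa q a)) -> 0 < eta ->
  exists2 k, nearly_elementary q a0 eps C k & `|T| - eta <= k T.
Proof.
move=> q1 qexp eta0; have [a [e [a1 e1 Tae]]] := b_norming T eta eta0.
have [qa0|qa0] := leP 0 (qa q a).
  by exists (fun T => b T a e) => //; exact: nearly_elementary_form.
(* Changing both signs leaves the form unchanged and makes [qa q a] nonnegative, as [0 <= m]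
   demands. *)
exists (fun T => b T (- a) (- e)).
  case: (qaP) => _ lqa _ _ _.
  apply: nearly_elementary_form; rewrite ?normrN//.
  by rewrite (linear_formN _ _ (lqa q)) oppr_ge0 ltW.
by rewrite (linear_formN _ _ (bA T _)) (linear_formN _ _ (bE T a)) opprK.
Qed.

Variable delta : R.
Hypothesis delta_gt0 : 0 < delta.
Hypothesis V_rough : weakly_average_rough V delta.
Hypothesis Q_non_rough : non_rough Q.

Lemma sphere_separated (e0 : E) (s : seq P) (eta d : R) : `|e0| = 1 -> 0 < eta ->
  d < delta -> exists e1 e2, [/\ `|e1| <= 1 /\ `|e2| <= 1,
    forall p, p \in s -> `|pe p e1 - pe p e0| < eta,
    forall p, p \in s -> `|pe p e2 - pe p e0| < eta & d < `|e1 - e2|].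
Proof.
move=> e01 eta0 dd; set g := delta - d.
have g0 : 0 < g by rewrite /g; lra.
have [q [C [q1 C0 qexp]]] :=
  non_rough_strongly_exposing _ qaP (g / 16) Q_non_rough ltac:(lra).
pose M := 1 + \sum_(p <- s) `|p|.
have sM p : p \in s -> `|p| <= M.
  move=> ps; rewrite /M (big_rem p)//= addrCA lerDl addr_ge0// sumr_ge0//.
have M1 : 1 <= M by rewrite lerDl sumr_ge0.
(* The errors on [s] will add up to at most [7 * k * M]. The two errors at [T] will add up to
   [g / 8 + (2 + 10 * C) * k <= g / 4], less than the margin [g / 2]. *)
have [k [k0 k1 kM kC]] : exists k, [/\ 0 < k, k <= 1, 8 * M * k < eta
    & (2 + 10 * C) * k <= g / 8].
  by apply: exists_small => //; lra.
case: (qaP) => _ lqa _ qaQ _; case: (peP) => lpe' lpe _ _ peE.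
have [a0 a01 qa0] := qaQ q k k0; rewrite q1 in qa0.
have [p0 p01 pe0] := peE e0 k k0; rewrite e01 in pe0.
have qa01 : qa q a0 <= 1.
  by rewrite -q1 (le_trans (ler_norm _))// (pairing_le_norm _ qaP).
(* Fixing [a' = a0], which attains the norm of [q] up to [k], leaves only the deficiency of [a], at
   the price of [C * k]. *)
have {}qexp a : `|a| <= 1 -> `|a - a0| <= (g / 16 + C * k) + C * (1 - qa q a).
  move=> a1; apply: le_trans (qexp a a0 a1 a01) _.
  have : C * (1 - qa q a0) <= C * k by rewrite ler_wpM2l//; lra.
  lra.
set eps := g / 16 + C * k in qexp.
have q1' : `|q| <= 1 by rewrite q1.
have e01' : `|e0| <= 1 by rewrite e01.
have [h0 h01 h0E] := dual_space_of_form _ (fun T => b T a0 e0) (bV a0 e0)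
  (fun T => form_le T a0 e0 a01 e01').
(* The extra point [p0] nearly norms [e0]; its tensor is the one that will force [m] close to 1. *)
pose s' := [seq tens q p | p <- p0 :: s].
have dg : d + g / 2 < delta by rewrite /g; lra.
have [h1 [h2 [[n1 n2] b1 b2 h12]]] :=
  (weakly_average_roughP _ _).1 V_rough h0 s' k (d + g / 2) h01 k0 dg.
have [T T1 hT] : exists2 T : V, `|T| <= 1 & d + g / 2 < h1 T - h2 T.
  by have [T] := dual_norm_adherent _ _ _ h12; exists T.
have pick (h : dual_space V) : `|h| <= 1 -> weak_star_basic h0 s' k h ->
  exists e, [/\ `|e| <= 1, forall p, p \in s -> `|pe p e - pe p e0| < eta
    & `|h T - b T a0 e| <= k + eps + C * (4 * k)].
  move=> hn hb.
  have hle v : h v <= `|v|.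
    rewrite (le_trans (ler_norm _))// (le_trans (op_normP h v))//.
    by rewrite ler_piMl.
  (* [T] joins the test points so that a single [u] approximates [h] both on the tensors and where
     [h1] and [h2] are far apart. *)
  have [u [lu ub [e [m [e1 /andP[m0 m1] c1 c2 c3]]]] hu] :=
    goldstine (nearly_elementary q a0 eps C) h (T :: s') k
      (fun k Kk => let: And3 lk kb _ := Kk in conj lk kb)
      (fun k k' t Kk Kk' t01 => nearly_elementary_convex q a0 eps C k k' t t01 Kk Kk')
      (fun T e => nearly_elementary_norming q a0 eps C T e q1' qexp)
      (bounded_op_linear h) hle k0.
  have ue p : p \in p0 :: s -> `|u (tens q p) - qa q a0 * pe p e0| <= 2 * k.
    move=> ps; have ps' : tens q p \in s' by apply: map_f.
    have := hb _ ps'; rewrite h0E b_tens => hb1.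
    have := hu (tens q p); rewrite in_cons ps' orbT => /(_ isT) hu1.
    have -> : u (tens q p) - qa q a0 * pe p e0 =
      (h (tens q p) - qa q a0 * pe p e0) - (h (tens q p) - u (tens q p)) by ring.
    rewrite (le_trans (ler_normB _ _))//.
    lra.
  (* At [tens q p0], [u] is at most [m] and at least [(1 - k) * (1 - k) - 2 * k], which exceeds
     [1 - 4 * k]. *)
  have m4 : 1 - m <= 4 * k.
    have := ue p0 (mem_head _ _); rewrite ler_norml => /andP[l _].
    have := le_trans (ler_norm _) (c2 p0) => l2.
    have : m * `|p0| <= m by rewrite ler_piMr.
    have : (1 - k) * (1 - k) <= qa q a0 * pe p0 e0 by rewrite ler_pM//; lra.
    have : 0 <= k * k by rewrite mulr_ge0// ltW.
    lra.
  exists e; split=> //.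
    move=> p ps; apply: le_lt_trans kM.
    have -> : pe p e - pe p e0 = (pe p e - u (tens q p)) +
       (u (tens q p) - qa q a0 * pe p e0) + (qa q a0 - 1) * pe p e0 by ring.
    have hp := sM p ps.
    have t1 : `|pe p e - u (tens q p)| <= 4 * k * M.
      by apply: le_trans (c1 p) _; rewrite ler_pM// subr_ge0.
    have t2 : `|u (tens q p) - qa q a0 * pe p e0| <= 2 * k * M.
      apply: le_trans (ue p _) _; first by rewrite in_cons ps orbT.
      by rewrite ler_peMr//; lra.
    have t3 : `|(qa q a0 - 1) * pe p e0| <= k * M.
      rewrite normrM ler_pM//; first by rewrite ler_norml; lra.
      exact: le_trans (pairing_le_norm _ peP p e0 e01') hp.
    have t4 : 0 <= k * M by rewrite mulr_ge0//; lra.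
    rewrite (le_trans (ler_normD _ _))// (le_trans (lerD (ler_normD _ _) (lexx _)))//.
    lra.
  have hu1 := hu T (mem_head _ _).
  have -> : h T - b T a0 e = (h T - u T) + (u T - b T a0 e) by ring.
  rewrite (le_trans (ler_normD _ _))//.
  have cT : 0 <= eps + C * (1 - m).
    by rewrite addr_ge0 ?mulr_ge0 ?subr_ge0//; rewrite /eps addr_ge0 ?mulr_ge0//; lra.
  have : `|T| * (eps + C * (1 - m)) <= eps + C * (1 - m) by rewrite ler_piMl.
  have : C * (1 - m) <= C * (4 * k) by rewrite ler_wpM2l.
  have := c3 T; lra.
have [e1 [e1n e1s e1T]] := pick h1 n1 b1.
have [e2 [e2n e2s e2T]] := pick h2 n2 b2.
exists e1, e2; split=> //.
have : b T a0 (e1 - e2) <= `|e1 - e2|.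
  rewrite (le_trans (ler_norm _))// (le_trans (b_le _ _ _))// ler_piMl//.
  by rewrite mulr_ile1.
rewrite (linear_formB _ _ _ (bE T a0)).
move: e1T e2T; rewrite !ler_norml /eps => /andP[_ u1] /andP[u2 _].
lra.
Qed.

Lemma ball_separated (e0 : E) (s : seq P) (eta d : R) : (exists e : E, e != 0) ->
  `|e0| <= 1 -> 0 < eta -> d < delta -> exists e1 e2, [/\ `|e1| <= 1 /\ `|e2| <= 1,
    forall p, p \in s -> `|pe p e1 - pe p e0| < eta,
    forall p, p \in s -> `|pe p e2 - pe p e0| < eta & d < `|e1 - e2|].
Proof.
move=> [u u0] e01 eta0 dd; case: (peP) => _ lpe peb _ _.
have [[z [z0 zs]]|noz] := pselect (exists z : E,
    z != 0 /\ forall p, p \in s -> pe p z = 0).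
  have [t t1] : exists t : R, `|e0 + t *: z| = 1.
    (* A displacement of length 2 takes [e0] out of the open unit ball, so the intermediate value
       theorem finds a crossing of the sphere on the way. *)
    have [c c0 cz] : exists2 c : R, 0 < c & c * `|z| = 2.
      exists (2 / `|z|); first by rewrite divr_gt0// normr_gt0.
      by rewrite mulfVK// normr_eq0.
    pose F (t : R) := `|e0 + t *: z|.
    have F0 : F 0 <= 1 by rewrite /F scale0r addr0.
    have F2 : 1 <= F c.
      have : `|c *: z| <= F c + `|e0|.
        by rewrite -[c *: z](addKr e0) addrC; exact: ler_normB.
      have -> : `|c *: z| = 2 by rewrite -cz -[X in X * _](gtr0_norm c0); exact: normrZ.
      lra.
    have cF : continuous F.
      move=> t; apply: cvg_norm; apply: cvgD; first exact: cvg_cst.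
      by apply: cvgZl; exact: cvg_id.
    have [|||t _ Ft] := @IVT R F 0 c 1.
    - exact: ltW.
    - exact: continuous_subspaceT.
    - by rewrite ge_min le_max F0 F2 orbT.
    by exists t.
  have [e1 [e2 [e12 e1s e2s de]]] := sphere_separated _ s eta d t1 eta0 dd.
  have pt p : p \in s -> pe p (e0 + t *: z) = pe p e0.
    move=> ps; rewrite (linear_formD _ _ _ (lpe p)) (linear_formZ _ _ _ (lpe p)).
    by rewrite zs// mulr0 addr0.
  exists e1, e2; split=> // p ps; rewrite -pt//; [exact: e1s|exact: e2s].
(* Otherwise [s] separates the points of [E], so it controls the norm of [E] and
   the separation at a point of the sphere is impossible. *)
exfalso; have d0 := delta_gt0; have [C C0 Cs] := annihilator_dist _ peP s.
have {}Cs e : `|e| <= C * \sum_(p <- s) `|pe p e|.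
  have [z zs] := Cs e; have [->|z0] := eqVneq z 0; first by rewrite subr0.
  by case: noz; exists z.
(* Two points within [k] of [v] on each [p] differ there by at most [2 * k], so their distance is at
   most [C * S * k], to be made smaller than [delta / 2]. *)
pose S : R := \sum_(p <- s) 2.
have S0 : 0 <= S by apply: sumr_ge0.
have [k [k0 _ kC _]] : exists k : R, [/\ 0 < k, k <= 1, C * S * k < delta / 2 & 0 * k <= 1].
  by apply: exists_small; rewrite ?mulr_ge0 ?divr_gt0.
pose v := `|u|^-1 *: u.
have v1 : `|v| = 1 by exact: normfZV.
have [e1 [e2 [_ e1s e2s]]] := sphere_separated v s k (delta / 2) v1 k0 ltac:(lra).
apply/negP; rewrite -leNgt; apply: le_trans (Cs _) _; apply: le_trans (ltW kC).
rewrite -mulrA ler_wpM2l// /S mulr_suml big_seq [leRHS]big_seq.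
apply: ler_sum => p ps; rewrite (linear_formB _ _ _ (lpe p)).
have -> : pe p e1 - pe p e2 = (pe p e1 - pe p v) - (pe p e2 - pe p v) by ring.
rewrite (le_trans (ler_normB _ _))//.
have := e1s p ps; have := e2s p ps; lra.
Qed.

(** A functional in the dual ball of [P] is first replaced on [s], within [eta / 2], by a point of
    the ball of [E]. Separated points near it act as functionals on [P], and their distance survives
    because the ball of [P] norms [E]. *)
Lemma predual_rough : (exists e : E, e != 0) -> weakly_average_rough P delta.
Proof.
move=> E0; apply/weakly_average_roughP => h s eta d h1 eta0 dd.
case: (peP) => lpe' lpe peb peP' peE.
have eta2 : 0 < eta / 2 by lra.
have hle v : h v <= `|v|.
  by rewrite (le_trans (ler_norm _))// (le_trans (op_normP h v))// ler_piMl.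
have [|||_ [e e1 <-] es] := goldstine [set (pe ^~ e) | e in [set e : E | `|e| <= 1]]
    h s (eta / 2) _ _ _ (bounded_op_linear h) hle eta2.
- by move=> _ [e /= e1 <-]; split=> // p; exact: pairing_le_norm.
- move=> _ _ t [e /= e1 <-] [e' /= e'1 <-] t01.
  exists ((1 - t) *: e + t *: e'); first exact: convex_ball.
  apply/funext => p.
  by rewrite (linear_formD _ _ _ (lpe p)) !(linear_formZ _ _ _ (lpe p)).
- move=> p c c0; have [e e1 pe1] := peP' p c c0.
  by exists (pe ^~ e) => //; exists e.
have [e1' [e2 [[n1 n2] s1 s2 de]]] := ball_separated e s (eta / 2) d E0 e1 eta2 dd.
have [g1 g1n g1E] :=
  dual_space_of_form _ (pe ^~ e1') (lpe' e1') (fun p => pairing_le_norm _ peP p e1' n1).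
have [g2 g2n g2E] :=
  dual_space_of_form _ (pe ^~ e2) (lpe' e2) (fun p => pairing_le_norm _ peP p e2 n2).
exists g1, g2; split=> // [p ps|p ps|].
- rewrite g1E; have := s1 p ps; have := es p ps.
  by rewrite !ltr_norml => /andP[? ?] /andP[? ?]; apply/andP; split; lra.
- rewrite g2E; have := s2 p ps; have := es p ps.
  by rewrite !ltr_norml => /andP[? ?] /andP[? ?]; apply/andP; split; lra.
apply: lt_le_trans de _; apply: (pairing_norm_le _ peP) => p p1.
rewrite (linear_formB _ _ _ (lpe p)) -g1E -g2E.
by rewrite (le_trans (ler_norm _))// (op_norm_ub (g1 - g2)).
Qed.

End Transfer.

(** * Rank-one operators and the bilinear form of an operator *)

Lemma op_norm_adherent {R : realType} (X Y : normedModType R)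
  (T : bounded_op X Y) c : c < `|T| -> exists2 x : X, `|x| <= 1 & c < `|T x|.
Proof.
move=> cT; apply: contrapT => nox; suff : `|T| <= c by rewrite leNgt cT.
apply: op_norm_le => x x1; rewrite leNgt; apply/negP => cx; apply: nox.
by exists x.
Qed.

Lemma norming_pairing_sym {R : realType} {P E : normedModType R} (f : P -> E -> R) :
  norming_pairing f -> norming_pairing (fun e p => f p e).
Proof. by case=> h1 h2 h3 h4 h5; split=> // p e; rewrite mulrC. Qed.

Lemma dual_pairing {R : realType} (Z : normedModType R) :
  norming_pairing (fun (f : dual_space Z) (z : Z) => f z : R).
Proof.
split=> [z a f g //|f|f z|f eta eta0|z eta eta0].
- exact: bounded_op_linear.
- exact: op_normP.
- have [z z1 fz] := dual_norm_adherent _ f (`|f| - eta) ltac:(lra).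
  by exists z => //; rewrite ltW.
- by have [f f1 fz] := norming_functional _ z; exists f => //; rewrite fz; lra.
Qed.

Lemma rank_one_op {R : realType} (X Y : normedModType R) (f : dual_space X) (y : Y) :
  exists2 T : bounded_op X Y, finite_rank T & forall x, T x = (f x : R) *: y.
Proof.
have lf := bounded_op_linear f.
have bT : (fun x => (f x : R) *: y) \in @bounded_linear R X Y.
  apply/asboolP; split=> [a u v|].
    by rewrite lf scalerDl scalerA.
  exists (`|f| * `|y|) => x; rewrite normrZ mulrAC ler_wpM2r//.
  exact: op_normP.
exists (BoundedOp bT) => //.
(* [finite_rank] wants the range to be exactly the span of the family: one vector if [f] is nonzero,
   the empty family otherwise. *)
have [[u fu]|f0] := pselect (exists u, f u != 0).
  exists 1%N, (fun=> y); apply/seteqP; split=> _ [x _ <-]/=.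
    by exists (fun=> f x) => //; rewrite big_ord1.
  exists ((x ord0 / f u) *: u) => //=; rewrite big_ord1.
  by rewrite (linear_formZ _ _ _ lf) mulfVK.
have {}f0 x : f x = 0.
  by apply/eqP; apply: contrapT => /negP fx; apply: f0; exists x.
exists 0%N, (fun=> 0); apply/seteqP; split=> _ [x _ <-]/=.
  by exists (fun=> 0) => //; rewrite big_ord0 f0 scale0r.
by exists 0 => //; rewrite big_ord0 f0 scale0r.
Qed.

Section OperatorForm.
Context {R : realType} {X Y : normedModType R} {H : submodClosed (bounded_op X Y)}.

Definition operator_form (T : subspace_of H) (x : X) (g : dual_space Y) : R :=
  g (subspace_val T x).

Lemma operator_form_le T x g : `|operator_form T x g| <= `|T| * `|x| * `|g|.
Proof.
rewrite mulrC (le_trans (op_normP g _))// ler_wpM2l ?op_norm_ge0//.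
exact: (op_normP (subspace_val T) x).
Qed.

Lemma operator_form_norming (T : subspace_of H) eta : 0 < eta ->
  exists x g, [/\ `|x| <= 1, `|g| <= 1 & `|T| - eta <= operator_form T x g].
Proof.
move=> eta0; have [|x x1 Tx] :=
  op_norm_adherent _ _ (subspace_val T) (`|T| - eta).
  by rewrite -[ltRHS]/`|T|; lra.
have [g g1 gE] := norming_functional _ (subspace_val T x).
by exists x, g; split=> //; rewrite /operator_form gE ltW.
Qed.

Lemma operator_form_linear_op x g :
  linear ((fun T => operator_form T x g) : subspace_of H -> R^o).
Proof. by move=> a S T; rewrite /operator_form/= (bounded_op_linear g). Qed.

Lemma operator_form_linear_vec T g :
  linear ((fun x => operator_form T x g) : X -> R^o).
Proof.
by move=> a x y; rewrite /operator_form (bounded_op_linear (subspace_val T)) (bounded_op_linear g).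
Qed.

End OperatorForm.

Theorem theorem3p5 (R : realType) (X Y : completeNormedModType R)
  (X_nontrivial : exists x : X, x != 0)
  (Y_nontrivial : exists y : Y, y != 0)
  (H : submodClosed (bounded_op X Y))
  (H_closed : closed [set T : bounded_op X Y | T \in H])
  (H_finite_rank : forall T : bounded_op X Y, finite_rank T -> T \in H)
  (delta : R) (delta_gt0 : 0 < delta)
  (H_rough : weakly_average_rough (subspace_of H) delta) :
  (non_rough (dual_space X) -> weakly_average_rough Y delta) /\
  (non_rough Y -> weakly_average_rough (dual_space X) delta).
Proof.
have rank1 (u : dual_space X * Y) : exists T : subspace_of H,
    forall x, subspace_val T x = (u.1 x : R) *: u.2.
  have [T /H_finite_rank TH TE] := rank_one_op _ _ u.1 u.2.
  by exists (SubspaceOf TH).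
have [tens tensE] := choice rank1.
split=> nr.
- apply: (@predual_rough R Y (dual_space Y) (dual_space X) X (subspace_of H)
    (fun y g => g y) (fun f x => f x) operator_form (fun f y => tens (f, y))) => //.
  + exact/norming_pairing_sym/dual_pairing.
  + exact: dual_pairing.
  + exact: operator_form_linear_op.
  + exact: operator_form_linear_vec.
  + exact: operator_form_le.
  + exact: operator_form_norming.
  + move=> f y x g; rewrite /operator_form tensE.
    exact: (linear_formZ _ _ _ (bounded_op_linear g)).
  + have [y y0] := Y_nontrivial; have [g _ gy] := norming_functional _ y.
    exists g; apply: contraNneq y0 => g0; rewrite -normr_eq0 -gy g0.
    by [].
(* For (b) the two arguments of the form trade places: vectors of [X] become the points to be
   separated, and functionals on [Y] are the points exposed by [Y]. *)
- apply: (@predual_rough R (dual_space X) X Y (dual_space Y) (subspace_of H)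
    (fun f x => f x) (fun y g => g y) (fun T g x => operator_form T x g)
    (fun y f => tens (f, y))) => //.
  + exact: dual_pairing.
  + exact/norming_pairing_sym/dual_pairing.
  + by move=> g x; exact: operator_form_linear_op.
  + by move=> T g; exact: operator_form_linear_vec.
  + by move=> T g x; rewrite mulrAC; exact: operator_form_le.
  + move=> T eta eta0; have [x [g [x1 g1 h]]] := operator_form_norming T eta eta0.
    by exists g, x.
  + move=> y f g x; rewrite /operator_form tensE mulrC.
    exact: (linear_formZ _ _ _ (bounded_op_linear g)).
Qed.
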